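(* Let $H:\mathfrak g\to\mathfrak h$ be a crossed homomorphism from a Lie-Yamaguti algebra $(\mathfrak g,[\cdot,\cdot]_{\mathfrak g},[\![\cdot,\cdot,\cdot]\!]_{\mathfrak g})$ to another Lie-Yamaguti algebra $(\mathfrak h,[\cdot,\cdot]_{\mathfrak h},[\![\cdot,\cdot,\cdot]\!]_{\mathfrak h})$ with respect to an action $(\rho,\mu)$. If two linear deformations $H_t^1=H+t\mathfrak H_1$ and $H_t^2=H+t\mathfrak H_2$ of $H$ are equivalent, then $\mathfrak H_1$ and $\mathfrak H_2$ are in the same cohomology class in $\mathcal H^1_H(\mathfrak g,\mathfrak h)$.
   Context: All vector spaces are finite-dimensional over a field $\mathbb K$ of characteristic $0$. A Lie-Yamaguti algebra is a vector space $\mathfrak g$ with a bilinear bracket $[\cdot,\cdot]:\wedge^2\mathfrak g\to\mathfrak g$ and a trilinear bracket $[\![\cdot,\cdot,\cdot]\!]:\wedge^2\mathfrak g\otimes\mathfrak g\to\mathfrak g$ (skew-symmetric in the first two arguments) such that for all $x,y,z,w,t\in\mathfrak g$: (1) $[[x,y],z]+[[y,z],x]+[[z,x],y]+[\![x,y,z]\!]+[\![y,z,x]\!]+[\![z,x,y]\!]=0$; (2) $[\![[x,y],z,w]\!]+[\![[y,z],x,w]\!]+[\![[z,x],y,w]\!]=0$; (3) $[\![x,y,[z,w]]\!]=[[\![x,y,z]\!],w]+[z,[\![x,y,w]\!]]$; (4) $[\![x,y,[\![z,w,t]\!]]\!]=[\![[\![x,y,z]\!],w,t]\!]+[\![z,[\![x,y,w]\!],t]\!]+[\![z,w,[\![x,y,t]\!]]\!]$.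 A homomorphism of Lie-Yamaguti algebras is a linear map preserving both brackets. A representation of $\mathfrak g$ on a vector space $V$ is a linear map $\rho:\mathfrak g\to\mathfrak{gl}(V)$ and a bilinear map $\mu:\otimes^2\mathfrak g\to\mathfrak{gl}(V)$ such that, with $D(x,y)=D_{\rho,\mu}(x,y):=\mu(y,x)-\mu(x,y)+[\rho(x),\rho(y)]-\rho([x,y])$, for all $x,y,z,w\in\mathfrak g$: $\mu([x,y],z)-\mu(x,z)\rho(y)+\mu(y,z)\rho(x)=0$; $\mu(x,[y,z])-\rho(y)\mu(x,z)+\rho(z)\mu(x,y)=0$; $\rho([\![x,y,z]\!])=[D(x,y),\rho(z)]$; $\mu(z,w)\mu(x,y)-\mu(y,w)\mu(x,z)-\mu(x,[\![y,z,w]\!])+D(y,z)\mu(x,w)=0$; $\mu([\![x,y,z]\!],w)+\mu(z,[\![x,y,w]\!])=[D(x,y),\mu(z,w)]$. The center of $\mathfrak h$ is $C(\mathfrak h):=\{u:[u,v]=0\ \forall v\}\cap\big(\{u:[\![u,v,w]\!]=0\ \forall v,w\}\cup\{u:[\![v,u,w]\!]=0\ \forall v,w\}\big)$. An action of $\mathfrak g$ on $\mathfrak h$ is a representation $(\rho,\mu)$ of $\mathfrak g$ on the vector space $\mathfrak h$ such that for all $x,y\in\mathfrak g$, $u,v,w\in\mathfrak h$: $\rho(x)u,\ \mu(x,y)u\in C(\mathfrak h)$; $\rho(x)[u,v]_{\mathfrak h}=\mu(x,y)[u,v]_{\mathfrak h}=0$; $\rho(x)[\![u,v,w]\!]_{\mathfrak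 h}=\mu(x,y)[\![u,v,w]\!]_{\mathfrak h}=0$. A crossed homomorphism from $\mathfrak g$ to $\mathfrak h$ with respect to $(\rho,\mu)$ is a linear map $H:\mathfrak g\to\mathfrak h$ such that for all $x,y,z\in\mathfrak g$: $H[x,y]_{\mathfrak g}=\rho(x)H(y)-\rho(y)H(x)+[Hx,Hy]_{\mathfrak h}$ and $H[\![x,y,z]\!]_{\mathfrak g}=D(x,y)H(z)+\mu(y,z)H(x)-\mu(x,z)H(y)+[\![Hx,Hy,Hz]\!]_{\mathfrak h}$. A homomorphism from a crossed homomorphism $H'$ to a crossed homomorphism $H$ (both with respect to $(\rho,\mu)$) is a pair of Lie-Yamaguti algebra homomorphisms $\psi_{\mathfrak g}:\mathfrak g\to\mathfrak g$, $\psi_{\mathfrak h}:\mathfrak h\to\mathfrak h$ with $\psi_{\mathfrak h}\circ H'=H\circ\psi_{\mathfrak g}$, $\psi_{\mathfrak h}(\rho(x)u)=\rho(\psi_{\mathfrak g}(x))\psi_{\mathfrak h}(u)$, $\psi_{\mathfrak h}(\mu(x,y)u)=\mu(\psi_{\mathfrak g}(x),\psi_{\mathfrak g}(y))\psi_{\mathfrak h}(u)$ for all $x,y\in\mathfrak g$, $u\in\mathfrak h$. A linear map $\mathfrak H:\mathfrak g\to\mathfrak h$ generates a linear deformation $H_t=H+t\mathfrak H$ of $H$ if $H+t\mathfrak H$ is a crossed homomorphism (with respect to $(\rho,\mu)$) for all $t$. For $\mathfrak X\in\wedge^2\mathfrak g$, $\mathfrak L(\mathfrak X)\in\mathfrak{gl}(\mathfrak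 g)$ and $D(\mathfrak X)\in\mathfrak{gl}(\mathfrak h)$ are the linear extensions of $\mathfrak L(x\wedge y)z=[\![x,y,z]\!]_{\mathfrak g}$ and $D(x\wedge y)=D(x,y)$. Two linear deformations $H_t^1=H+t\mathfrak H_1$ and $H_t^2=H+t\mathfrak H_2$ are equivalent if there is $\mathfrak X\in\wedge^2\mathfrak g$ such that $(\mathrm{Id}_{\mathfrak g}+t\mathfrak L(\mathfrak X),\mathrm{Id}_{\mathfrak h}+tD(\mathfrak X))$ is a homomorphism from $H_t^2$ to $H_t^1$ (for all $t$). First cohomology group of $H$: let $\rho_H(x)u=[Hx,u]_{\mathfrak h}+\rho(x)u$, $\mu_H(x,y)u=[\![u,Hx,Hy]\!]_{\mathfrak h}+\mu(x,y)u$, $D_H(x,y)u=[\![Hx,Hy,u]\!]_{\mathfrak h}+D(x,y)u$. The $1$-cocycles $\mathcal Z^1_H(\mathfrak g,\mathfrak h)$ are the $f\in\mathrm{Hom}(\mathfrak g,\mathfrak h)$ with $\rho_H(x)f(y)-\rho_H(y)f(x)-f([x,y]_{\mathfrak g})=0$ and $D_H(x,y)f(z)+\mu_H(y,z)f(x)-\mu_H(x,z)f(y)-f([\![x,y,z]\!]_{\mathfrak g})=0$ for all $x,y,z\in\mathfrak g$. The $1$-coboundaries $\mathcal B^1_H(\mathfrak g,\mathfrak h)$ are the maps $\partial(\mathfrak X)$, $\mathfrak X\in\wedge^2\mathfrak g$, where $\partial:\wedge^2\mathfrak g\to\mathrm{Hom}(\mathfrak g,\mathfrak h)$ is the linear map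 with $\partial(x\wedge y)(z)=\mu(y,z)(Hx)-\mu(x,z)(Hy)+[\![Hx,Hy,Hz]\!]_{\mathfrak h}$. Then $\mathcal H^1_H(\mathfrak g,\mathfrak h)=\mathcal Z^1_H(\mathfrak g,\mathfrak h)/\mathcal B^1_H(\mathfrak g,\mathfrak h)$. *)

(* Defs.v *)
From HB Require Import structures.
From mathcomp Require Import all_boot all_order all_algebra.
From mathcomp Require Import ring.

Set Implicit Arguments.
Unset Strict Implicit.
Unset Printing Implicit Defensive.

Import GRing.Theory.
Local Open Scope ring_scope.

(* The brackets [lybr] and [lytri] are curried (tri)linear maps, so that *)
(* [lytri x y] is itself the endomorphism z |-> [[x, y, z]]. *)
HB.mixin Record isLieYamaguti (K : fieldType) (g : Type) of Vector K g := {
  lybr : 'Hom(g, 'End(g));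
  lytri : 'Hom(g, 'Hom(g, 'End(g)));
  lybr_alt : forall x : g, lybr x x = 0;
  lytri_alt : forall x : g, lytri x x = 0;
  ly_jacobi : forall x y z : g,
    lybr (lybr x y) z + lybr (lybr y z) x + lybr (lybr z x) y
    + lytri x y z + lytri y z x + lytri z x y = 0;
  ly_cyclic : forall x y z w : g,
    lytri (lybr x y) z w + lytri (lybr y z) x w + lytri (lybr z x) y w = 0;
  lytri_br : forall x y z w : g,
    lytri x y (lybr z w) = lybr (lytri x y z) w + lybr z (lytri x y w);
  lytri_tri : forall x y z w t : g,
    lytri x y (lytri z w t) =
      lytri (lytri x y z) w t + lytri z (lytri x y w) t
      + lytri z w (lytri x y t)
}.

#[short(type="lieYamagutiType")]
HB.structure Definition LieYamaguti (K : fieldType) :=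
  { g of Vector K g & isLieYamaguti K g }.

Definition ly_hom (K : fieldType) (g g' : lieYamagutiType K)
    (f : 'Hom(g, g')) : Prop :=
  (forall x y : g, f (lybr x y) = lybr (f x) (f y)) /\
  (forall x y z : g, f (lytri x y z) = lytri (f x) (f y) (f z)).

Section LieYamagutiTheory.
Variables (K : fieldType) (g : lieYamagutiType K).
Implicit Types x y z : g.

Lemma lybrC x y : lybr y x = - lybr x y.
Proof.
apply/eqP; rewrite -addr_eq0; have := lybr_alt (x + y).
by rewrite !linearD /= !add_lfunE !lybr_alt add0r addr0 => ->.
Qed.

Lemma lytriC x y : lytri y x = - lytri x y.
Proof.
apply/eqP; rewrite -addr_eq0; have := lytri_alt (x + y).
by rewrite !linearD /= !add_lfunE !lytri_alt add0r addr0 => ->.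
Qed.

End LieYamagutiTheory.

Section LinearClosure.
Variables (K : fieldType) (U V W : vectType K).

Lemma linfunE (F : U -> V) : linear F -> linfun F =1 F.
Proof.
move=> lF; pose f : {linear U -> V} :=
  HB.pack F (GRing.isLinear.Build K U V *:%R F lF).
exact: (lfunE f).
Qed.

Lemma linear_idf : linear (fun x : U => x). Proof. by []. Qed.

Lemma linear_addf (F G : U -> V) :
  linear F -> linear G -> linear (fun x => F x + G x).
Proof. by move=> lF lG a x y; rewrite lF lG scalerDr addrACA. Qed.

Lemma linear_oppf (F : U -> V) : linear F -> linear (fun x => - F x).
Proof. by move=> lF a x y; rewrite lF opprD scalerN. Qed.

Lemma linear_scalef (c : K) (F : U -> V) :
  linear F -> linear (fun x => c *: F x).
Proof. by move=> lF a x y; rewrite lF scalerDr !scalerA mulrC. Qed.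

Lemma linear_compf (f : 'Hom(V, W)) (F : U -> V) :
  linear F -> linear (fun x => f (F x)).
Proof. by move=> lF a x y; rewrite lF linearP. Qed.

Lemma linear_appf (F : U -> 'Hom(V, W)) (v : V) :
  linear F -> linear (fun x => F x v).
Proof. by move=> lF a x y; rewrite lF add_lfunE scale_lfunE. Qed.

End LinearClosure.

Lemma linear_linfun (K : fieldType) (U V W : vectType K)
    (F : U -> V -> W) :
    (forall x, linear (F x)) -> (forall y, linear (F^~ y)) ->
  linear (fun x => linfun (F x)).
Proof.
move=> lF1 lF2 a x y; apply/lfunP => v.
by rewrite /= add_lfunE scale_lfunE !linfunE ?lF2.
Qed.

Lemma linfun2E (K : fieldType) (U V W : vectType K) (F : U -> V -> W) :
    (forall y, linear (F^~ y)) -> (forall x, linear (F x)) ->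
  forall x y, linfun (fun x => linfun (F x)) x y = F x y.
Proof.
move=> lF1 lF2 x y; rewrite [X in fun_of_lfun X]linfunE ?linfunE //.
exact: linear_linfun.
Qed.

Lemma linfun3E (K : fieldType) (U V W T : vectType K) (F : U -> V -> W -> T) :
    (forall y z, linear (fun x => F x y z)) ->
    (forall x z, linear (fun y => F x y z)) ->
    (forall x y, linear (F x y)) ->
  forall x y z,
    linfun (fun x => linfun (fun y => linfun (F x y))) x y z = F x y z.
Proof.
move=> lF1 lF2 lF3 x y z.
rewrite [X in fun_of_lfun (fun_of_lfun X _)]linfunE.
  by rewrite linfun2E.
by apply: linear_linfun => [v|v]; apply: linear_linfun.
Qed.

Lemma linear_compl (K : fieldType) (U V W T : vectType K) (f : 'Hom(V, W))
    (F : U -> 'Hom(T, V)) : linear F -> linear (fun x => (f \o F x)%VF).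
Proof. by move=> lF a x y; rewrite lF comp_lfunDr -comp_lfunZr. Qed.

Lemma linear_compr (K : fieldType) (U V W T : vectType K) (f : 'Hom(T, V))
    (F : U -> 'Hom(V, W)) : linear F -> linear (fun x => (F x \o f)%VF).
Proof. by move=> lF a x y; rewrite lF comp_lfunDl -comp_lfunZl. Qed.

Ltac solve_linear := repeat first
  [ exact: linear_idf
  | apply: linear_addf | apply: linear_oppf
  | apply: linear_compl | apply: linear_compr
  | apply: linear_compf | apply: linear_appf ].

(* The exterior square in coordinates: [wedge2 g] has the basis e_i /\ e_j, *)
(* i < j, for e the basis [vbasis fullv] of g. *)
Section ExteriorSquare.
Variables (K : fieldType) (g : vectType K).

Definition pair_lt (p : 'I_(\dim {:g}) * 'I_(\dim {:g})) : bool :=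
  (p.1 < p.2)%N.

Definition wedge2 : vectType K := {ffun {p | pair_lt p} -> K^o}.

Definition wedge (x y : g) : wedge2 :=
  [ffun p => coord (vbasis {:g}) (val p).1 x * coord (vbasis {:g}) (val p).2 y
           - coord (vbasis {:g}) (val p).2 x * coord (vbasis {:g}) (val p).1 y].

Lemma wedge2_sum (X : wedge2) :
  X = \sum_(p : {p | pair_lt p})
     X p *: wedge (vbasis {:g})`_(val p).1 (vbasis {:g})`_(val p).2.
Proof.
have cE (i j : 'I_(\dim {:g})) :
    coord (vbasis {:g}) i (vbasis {:g})`_j = (j == i)%:R.
  by rewrite coord_free // (basis_free (vbasisP _)).
have wE (p q : {p | pair_lt p}) :
    wedge (vbasis {:g})`_(val p).1 (vbasis {:g})`_(val p).2 q = (p == q)%:R.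
  rewrite ffunE !cE -!natrM !mulnb -xpair_eqE -!surjective_pairing val_eqE.
  have -> : ((val p).1 == (val q).2) && ((val p).2 == (val q).1) = false.
    apply/negP => /andP[/eqP e1 /eqP e2]; have := valP p; have := valP q.
    by rewrite /pair_lt e1 e2 => /ltnW; rewrite leqNgt => /negPf ->.
  by rewrite subr0.
apply/ffunP => q; rewrite sum_ffunE (bigD1 q) //= big1 => [|p /negPf neq_pq].
  by rewrite addr0 ffunE wE eqxx [RHS]mulr1.
by rewrite ffunE wE neq_pq; apply: mulr0.
Qed.

Lemma wedge_alt x : wedge x x = 0.
Proof. by apply/ffunP => p; rewrite !ffunE mulrC subrr. Qed.

Lemma wedge_linl y : linear (wedge^~ y).
Proof.
move=> a x x'; apply/ffunP => p; rewrite !ffunE !linearP /=.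
by rewrite /GRing.scale /=; ring.
Qed.

Lemma wedge_linr x : linear (wedge x).
Proof.
move=> a y y'; apply/ffunP => p; rewrite !ffunE !linearP /=.
by rewrite /GRing.scale /=; ring.
Qed.

Section Extension.
Variables (V : vectType K) (phi : g -> g -> V).

(* For phi bilinear and alternating, the linear map on the exterior square *)
(* such that x /\ y |-> phi x y: see [wedge_ext_wedge], [wedge_ext_unique]. *)
Definition wedge_ext (X : wedge2) : V :=
  \sum_(p : {p | pair_lt p})
     X p *: phi (vbasis {:g})`_(val p).1 (vbasis {:g})`_(val p).2.

Lemma wedge_ext_linear : linear wedge_ext.
Proof.
move=> a X Y; rewrite /wedge_ext scaler_sumr -big_split /=.
by apply: eq_bigr => p _; rewrite !ffunE scalerDl scalerA.
Qed.

Hypothesis phi_linl : forall y, linear (phi^~ y).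
Hypothesis phi_linr : forall x, linear (phi x).
Hypothesis phi_alt : forall x, phi x x = 0.

Let phi0l y : phi 0 y = 0.
Proof.
by have := phi_linl y (-1) 0 0; rewrite scaler0 addr0 scaleN1r addNr.
Qed.
Let phi0r x : phi x 0 = 0.
Proof.
by have := phi_linr x (-1) 0 0; rewrite scaler0 addr0 scaleN1r addNr.
Qed.
Let phiDl x x' y : phi (x + x') y = phi x y + phi x' y.
Proof. by rewrite -[x in LHS]scale1r phi_linl scale1r. Qed.
Let phiDr x y y' : phi x (y + y') = phi x y + phi x y'.
Proof. by rewrite -[y in LHS]scale1r phi_linr scale1r. Qed.
Let phiZl a x y : phi (a *: x) y = a *: phi x y.
Proof. by rewrite -[_ *: x]addr0 phi_linl phi0l addr0. Qed.
Let phiZr a x y : phi x (a *: y) = a *: phi x y.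
Proof. by rewrite -[_ *: y]addr0 phi_linr phi0r addr0. Qed.
Let phi_suml (I : finType) (F : I -> g) y :
  phi (\sum_i F i) y = \sum_i phi (F i) y.
Proof. exact: (big_morph (phi^~ y) (fun a b => phiDl a b y) (phi0l y)). Qed.
Let phi_sumr (I : finType) (F : I -> g) x :
  phi x (\sum_i F i) = \sum_i phi x (F i).
Proof. exact: (big_morph (phi x) (phiDr x) (phi0r x)). Qed.
Let phi_skew x y : phi y x = - phi x y.
Proof.
apply/eqP; rewrite -addr_eq0; have := phi_alt (x + y).
by rewrite phiDl !phiDr !phi_alt add0r addr0 addrC => ->.
Qed.

Lemma wedge_ext_wedge x y : wedge_ext (wedge x y) = phi x y.
Proof.
pose b := vbasis {:g}; pose c i z := coord b i z.
have -> : phi x y =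
    \sum_(p : 'I_(\dim {:g}) * 'I_(\dim {:g}))
       (c p.1 x * c p.2 y) *: phi b`_p.1 b`_p.2.
  rewrite [in LHS](coord_vbasis (memvf x)) [in LHS](coord_vbasis (memvf y)).
  rewrite phi_suml -(pair_bigA _ (fun i j => (c i x * c j y) *: phi b`_i b`_j)).
  apply: eq_bigr => i _ /=; rewrite phi_sumr; apply: eq_bigr => j _.
  by rewrite phiZl phiZr scalerA.
rewrite (bigID pair_lt) /= [X in _ + X](bigID (fun p => pair_lt (p.2, p.1))) /=.
rewrite [X in _ + (_ + X)]big1 ?addr0; last first.
  move=> [i j] /andP[]; rewrite /pair_lt /= -!leqNgt => le1 le2.
  have -> : i = j by apply/val_inj/anti_leq/andP.
  by rewrite phi_alt scaler0.
rewrite [X in _ + X](reindex_inj (h := fun p => (p.2, p.1))) /=; last first.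
  by move=> [i j] [k l] /= [-> ->].
rewrite [X in _ + X](eq_bigl pair_lt); last first.
  move=> [i j]; rewrite /pair_lt /= -leqNgt.
  by apply: andb_idl => /ltnW.
rewrite -big_split /=.
rewrite /wedge_ext [RHS](reindex_omap (val : {p | pair_lt p} -> _) insub) /=;
  last first.
  by move=> p lt_p; rewrite insubT.
apply: eq_big => [p|p _]; first by rewrite (valP p) valK eqxx.
by rewrite ffunE /= scalerBl (phi_skew b`_(val p).1) scalerN.
Qed.

Lemma wedge_ext_unique (F : wedge2 -> V) :
  linear F -> (forall x y, F (wedge x y) = phi x y) -> F =1 wedge_ext.
Proof.
move=> lF FE X; rewrite -(linfunE lF) [in LHS](wedge2_sum X) linear_sum.
by apply: eq_bigr => p _; rewrite linearZ /= linfunE // FE.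
Qed.

End Extension.
End ExteriorSquare.

Section Representation.
Variables (K : fieldType) (g : lieYamagutiType K) (V : vectType K).
Variables (rho : 'Hom(g, 'End(V))) (mu : 'Hom(g, 'Hom(g, 'End(V)))).

Definition lcomm (a b : 'End(V)) : 'End(V) := (a \o b)%VF - (b \o a)%VF.

Definition repD (x y : g) : 'End(V) :=
  mu y x - mu x y + lcomm (rho x) (rho y) - rho (lybr x y).

Record is_rep : Prop := IsRep {
  rep_mu_brl : forall x y z : g,
    mu (lybr x y) z - (mu x z \o rho y)%VF + (mu y z \o rho x)%VF = 0;
  rep_mu_brr : forall x y z : g,
    mu x (lybr y z) - (rho y \o mu x z)%VF + (rho z \o mu x y)%VF = 0;
  rep_rho_tri : forall x y z : g,
    rho (lytri x y z) = lcomm (repD x y) (rho z);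
  rep_mu_mu : forall x y z w : g,
    (mu z w \o mu x y)%VF - (mu y w \o mu x z)%VF - mu x (lytri y z w)
    + (repD y z \o mu x w)%VF = 0;
  rep_mu_tri : forall x y z w : g,
    mu (lytri x y z) w + mu z (lytri x y w) = lcomm (repD x y) (mu z w)
}.

Lemma repDE x y v :
  repD x y v = mu y x v - mu x y v + (rho x (rho y v) - rho y (rho x v))
               - rho (lybr x y) v.
Proof. by rewrite /repD /lcomm !(add_lfunE, opp_lfunE, comp_lfunE). Qed.

Lemma rep_rho_triE : is_rep -> forall x y z v,
  rho (lytri x y z) v = repD x y (rho z v) - rho z (repD x y v).
Proof.
by move=> r x y z v; rewrite rep_rho_tri // add_lfunE opp_lfunE !comp_lfunE.
Qed.

Lemma rep_mu_triE : is_rep -> forall x y z w v,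
  mu (lytri x y z) w v + mu z (lytri x y w) v
    = repD x y (mu z w v) - mu z w (repD x y v).
Proof.
move=> r x y z w v.
by rewrite -add_lfunE rep_mu_tri // add_lfunE opp_lfunE !comp_lfunE.
Qed.

End Representation.

Definition in_center (K : fieldType) (h : lieYamagutiType K) (u : h) : Prop :=
  (forall v : h, lybr u v = 0) /\
  ((forall v w : h, lytri u v w = 0) \/ (forall v w : h, lytri v u w = 0)).

Lemma in_centerP (K : fieldType) (h : lieYamagutiType K) (u : h) :
    in_center u ->
  [/\ forall v, lybr u v = 0, forall v, lybr v u = 0,
      forall v w, lytri u v w = 0, forall v w, lytri v u w = 0 &
      forall v w, lytri v w u = 0].
Proof.
case=> u1 u2.
have u1' v : lybr v u = 0 by rewrite lybrC u1 oppr0.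
have u3 v w : lytri u v w = 0.
  by case: u2 => // u2; rewrite lytriC opp_lfunE u2 oppr0.
have u3' v w : lytri v u w = 0 by rewrite lytriC opp_lfunE u3 oppr0.
split=> // v w; have := ly_jacobi v w u.
by rewrite !(u1, u1', u3, u3', linear0, zero_lfunE, add0r, addr0).
Qed.

Section CrossedHomomorphism.
Variables (K : fieldType) (g h : lieYamagutiType K).
Variables (rho : 'Hom(g, 'End(h))) (mu : 'Hom(g, 'Hom(g, 'End(h)))).

Record is_action : Prop := IsAction {
  action_rep : is_rep rho mu;
  action_rho_center : forall (x : g) (u : h), in_center (rho x u);
  action_mu_center : forall (x y : g) (u : h), in_center (mu x y u);
  action_rho_br : forall (x : g) (u v : h), rho x (lybr u v) = 0;
  action_mu_br : forall (x y : g) (u v : h), mu x y (lybr u v) = 0;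
  action_rho_tri : forall (x : g) (u v w : h), rho x (lytri u v w) = 0;
  action_mu_tri : forall (x y : g) (u v w : h), mu x y (lytri u v w) = 0
}.

Definition crossed_hom (H : 'Hom(g, h)) : Prop :=
  (forall x y : g,
     H (lybr x y) = rho x (H y) - rho y (H x) + lybr (H x) (H y)) /\
  (forall x y z : g,
     H (lytri x y z) = repD rho mu x y (H z) + mu y z (H x) - mu x z (H y)
                       + lytri (H x) (H y) (H z)).

(* (psi_g, psi_h) is a homomorphism from H' to H. *)
Record crossed_hom_morphism (H' H : 'Hom(g, h)) (psi_g : 'End(g))
    (psi_h : 'End(h)) : Prop := CrossedHomMorphism {
  chm_ly_hom_g : ly_hom psi_g;
  chm_ly_hom_h : ly_hom psi_h;
  chm_comm : (psi_h \o H')%VF = (H \o psi_g)%VF;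
  chm_rho : forall (x : g) (u : h), psi_h (rho x u) = rho (psi_g x) (psi_h u);
  chm_mu : forall (x y : g) (u : h),
    psi_h (mu x y u) = mu (psi_g x) (psi_g y) (psi_h u)
}.

Definition linear_deformation (H H1 : 'Hom(g, h)) : Prop :=
  forall t : K, crossed_hom (H + t *: H1).

Definition wedgeL (X : wedge2 g) : 'End(g) :=
  wedge_ext (fun x y => lytri x y) X.

Definition wedgeD (X : wedge2 g) : 'End(h) := wedge_ext (repD rho mu) X.

Definition equiv_deformations (H H1 H2 : 'Hom(g, h)) : Prop :=
  exists X : wedge2 g, forall t : K,
    crossed_hom_morphism (H + t *: H2) (H + t *: H1)
      (\1%VF + t *: wedgeL X) (\1%VF + t *: wedgeD X).

Lemma repD_linl (y : g) : linear ((repD rho mu)^~ y).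
Proof. by rewrite /repD /lcomm; solve_linear. Qed.
Lemma repD_linr (x : g) : linear (repD rho mu x).
Proof. by rewrite /repD /lcomm; solve_linear. Qed.
Lemma repD_alt (x : g) : repD rho mu x x = 0.
Proof. by rewrite /repD /lcomm !subrr lybr_alt linear0 subr0 addr0. Qed.

Lemma wedgeL_wedge (x y : g) : wedgeL (wedge x y) = lytri x y.
Proof.
apply: (@wedge_ext_wedge _ _ _ (fun x y => lytri x y)) => [v|v|].
- by solve_linear.
- by solve_linear.
exact: lytri_alt.
Qed.

Lemma wedgeD_wedge (x y : g) : wedgeD (wedge x y) = repD rho mu x y.
Proof. exact: wedge_ext_wedge repD_linl repD_linr repD_alt x y. Qed.

Section Cohomology.
Variable H : 'Hom(g, h).

Definition rhoH (x : g) (u : h) : h := lybr (H x) u + rho x u.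
Definition muH (x y : g) (u : h) : h := lytri u (H x) (H y) + mu x y u.
Definition repDH (x y : g) (u : h) : h :=
  lytri (H x) (H y) u + repD rho mu x y u.

Definition cocycle (f : 'Hom(g, h)) : Prop :=
  (forall x y : g, rhoH x (f y) - rhoH y (f x) - f (lybr x y) = 0) /\
  (forall x y z : g,
     repDH x y (f z) + muH y z (f x) - muH x z (f y) - f (lytri x y z) = 0).

(* The linear operator with kernel Z^1: see [cocyclesP]. *)
Definition cocycle_op (f : 'Hom(g, h)) :
    ('Hom(g, 'Hom(g, h)) * 'Hom(g, 'Hom(g, 'Hom(g, h))))%type :=
  (linfun (fun x => linfun (fun y =>
     rhoH x (f y) - rhoH y (f x) - f (lybr x y))),
   linfun (fun x => linfun (fun y => linfun (fun z =>
     repDH x y (f z) + muH y z (f x) - muH x z (f y) - f (lytri x y z))))).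

Definition cocycles : {vspace 'Hom(g, h)} := lker (linfun cocycle_op).

Ltac solve_lin := rewrite /rhoH /muH /repDH /repD /lcomm; solve_linear.


Lemma cocycle_op1E f x y :
  (cocycle_op f).1 x y = rhoH x (f y) - rhoH y (f x) - f (lybr x y).
Proof. by rewrite /= linfun2E // => {x y} u; solve_lin. Qed.

Lemma cocycle_op2E f x y z :
  (cocycle_op f).2 x y z =
    repDH x y (f z) + muH y z (f x) - muH x z (f y) - f (lytri x y z).
Proof. by rewrite /= linfun3E // => {x y z} u v; solve_lin. Qed.

Lemma cocycle_op_linear : linear cocycle_op.
Proof.
have l1 x y : linear (fun f : 'Hom(g, h) => (cocycle_op f).1 x y).
  move=> a f1 f2; rewrite !cocycle_op1E; move: a f1 f2.
  by rewrite -/(linear (fun f : 'Hom(g, h) =>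
    rhoH x (f y) - rhoH y (f x) - f (lybr x y))); solve_lin.
have l2 x y z : linear (fun f : 'Hom(g, h) => (cocycle_op f).2 x y z).
  move=> a f1 f2; rewrite !cocycle_op2E; move: a f1 f2.
  by rewrite -/(linear (fun f : 'Hom(g, h) =>
    repDH x y (f z) + muH y z (f x) - muH x z (f y) - f (lytri x y z)));
    solve_lin.
move=> a f1 f2; rewrite [LHS]surjective_pairing [RHS]surjective_pairing.
congr (_, _); apply/lfunP => x; apply/lfunP => y; last apply/lfunP => z.
  by rewrite l1 !(add_lfunE, scale_lfunE).
by rewrite l2 !(add_lfunE, scale_lfunE).
Qed.

Lemma cocyclesP f : reflect (cocycle f) (f \in cocycles).
Proof.
rewrite memv_ker linfunE; last exact: cocycle_op_linear.
apply: (iffP eqP) => [f0|[f1 f2]].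
  split=> [x y|x y z]; first by rewrite -cocycle_op1E f0 !zero_lfunE.
  by rewrite -cocycle_op2E f0 !zero_lfunE.
rewrite [LHS]surjective_pairing.
congr (_, _); apply/lfunP => x; apply/lfunP => y; last apply/lfunP => z.
  by rewrite cocycle_op1E f1 !zero_lfunE.
by rewrite cocycle_op2E f2 !zero_lfunE.
Qed.

(* The coboundary operator on decomposable elements: [cobound_wedge]. *)
Definition cobound_fun (x y : g) : 'Hom(g, h) :=
  linfun (fun z => mu y z (H x) - mu x z (H y) + lytri (H x) (H y) (H z)).

Lemma cobound_funE x y z :
  cobound_fun x y z = mu y z (H x) - mu x z (H y) + lytri (H x) (H y) (H z).
Proof. by rewrite linfunE //; solve_lin. Qed.

Definition cobound : 'Hom(wedge2 g, 'Hom(g, h)) :=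
  linfun (wedge_ext cobound_fun).

Definition coboundaries : {vspace 'Hom(g, h)} := limg cobound.

Lemma cobound_wedge x y : cobound (wedge x y) = cobound_fun x y.
Proof.
rewrite linfunE; last exact: wedge_ext_linear.
rewrite wedge_ext_wedge // => [v|v|v].
- apply: linear_linfun => w; solve_lin.
- apply: linear_linfun => w; solve_lin.
- by apply/lfunP => z; rewrite cobound_funE lytri_alt !zero_lfunE subrr addr0.
Qed.

Lemma coboundariesP f :
  reflect (exists X, f = cobound X) (f \in coboundaries).
Proof.
apply: (iffP memv_imgP) => [[X _ ->]|[X ->]]; exists X => //.
exact: memvf.
Qed.

(* H^1 = Z^1 / B^1, where B^1 is pulled back along the inclusion of Z^1; for *)
(* a crossed homomorphism H with respect to an action it is contained in Z^1, *)
(* see [sub_coboundaries_cocycles]. *)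
Definition cohomology1 : zmodType :=
  Quotient.quot (linfun (@vsval K _ cocycles) @^-1: coboundaries)%VS.

Definition cohomology_class (f : 'Hom(g, h)) (Zf : f \in cocycles) :
  cohomology1 := \pi_cohomology1%qT (Subvs Zf).

Lemma cohomology_class_eq f1 f2 (Z1 : f1 \in cocycles) (Z2 : f2 \in cocycles) :
  cohomology_class Z1 = cohomology_class Z2 <-> f1 - f2 \in coboundaries.
Proof.
rewrite (rwP eqP) /cohomology_class -Quotient.idealrBE.
by rewrite -memv_preim lfunE.
Qed.

(* An infinitesimal automorphism (T, d) of the action yields a cocycle. *)
Section InfinitesimalAutomorphism.
Variables (T : 'End(g)) (d : 'End(h)).
Hypothesis chH : crossed_hom H.
Hypothesis T_br : forall a b, T (lybr a b) = lybr (T a) b + lybr a (T b).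
Hypothesis T_tri : forall a b c,
  T (lytri a b c) = lytri (T a) b c + lytri a (T b) c + lytri a b (T c).
Hypothesis d_br : forall u v, d (lybr u v) = 0.
Hypothesis d_tri : forall u v w, d (lytri u v w) = 0.
Hypothesis br_d : forall u v, lybr u (d v) = 0.
Hypothesis tri_d1 : forall u v w, lytri (d u) v w = 0.
Hypothesis tri_d3 : forall u v w, lytri u v (d w) = 0.
Hypothesis d_rho : forall z u, d (rho z u) = rho (T z) u + rho z (d u).
Hypothesis d_mu : forall z w u,
  d (mu z w u) = mu (T z) w u + mu z (T w) u + mu z w (d u).

Let coord_inj (u v : h) :
  (forall i, coord (vbasis {:h}) i u = coord (vbasis {:h}) i v) -> u = v.
Proof.
move=> uv; rewrite (coord_vbasis (memvf u)) (coord_vbasis (memvf v)).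
by apply: eq_bigr => i _; rewrite uv.
Qed.

Let linD (U V : vectType K) (f : 'Hom(U, V)) u v : f (u + v) = f u + f v.
Proof. exact: linearD. Qed.
Let linN (U V : vectType K) (f : 'Hom(U, V)) u : f (- u) = - f u.
Proof. exact: linearN. Qed.
Let coordD (i : 'I_(\dim {:h})) (u v : h) : coord (vbasis {:h}) i (u + v)
  = coord (vbasis {:h}) i u + coord (vbasis {:h}) i v.
Proof. exact: linearD. Qed.
Let coordN (i : 'I_(\dim {:h})) (u : h) : coord (vbasis {:h}) i (- u)
  = - coord (vbasis {:h}) i u.
Proof. exact: linearN. Qed.
Let coord0 (i : 'I_(\dim {:h})) : coord (vbasis {:h}) i 0 = 0.
Proof. exact: linear0. Qed.

Let d_D a b u :
  d (repD rho mu a b u) =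
    repD rho mu (T a) b u + repD rho mu a (T b) u + repD rho mu a b (d u).
Proof.
rewrite !repDE !(linD, linN) !(d_mu, d_rho) T_br !(linD, linN, add_lfunE).
by apply: coord_inj => i; rewrite !(coordD, coordN); ring.
Qed.

Lemma inf_aut_cocycle (f : 'Hom(g, h)) :
  (forall z, f z = H (T z) - d (H z)) -> f \in cocycles.
Proof.
move=> fE; have [H_br H_tri] := chH; apply/cocyclesP; split=> [a b|a b c].
  rewrite /rhoH !fE T_br !(linD H) !H_br !(linD, linN).
  rewrite !d_rho d_br !br_d [lybr (H b) (H (T a))]lybrC.
  by apply: coord_inj => i; rewrite !(coordD, coordN, coord0); ring.
have tri1 u v w z : lytri (u - d v) w z = lytri u w z.
  by rewrite linD linN add_lfunE opp_lfunE add_lfunE opp_lfunE tri_d1 subr0.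
have tri3 u v w z : lytri w z (u - d v) = lytri w z u.
  by rewrite linD linN tri_d3 subr0.
rewrite /repDH /muH !fE T_tri !(linD H) !H_tri !tri1 tri3.
rewrite [lytri (H (T b)) _]lytriC opp_lfunE !linD !linN.
rewrite !d_mu d_D d_tri.
by apply: coord_inj => i; rewrite !(coordD, coordN, coord0); ring.
Qed.

End InfinitesimalAutomorphism.

Section Coboundaries.
Hypotheses (act : is_action) (chH : crossed_hom H).
Variables x y : g.

Let d_center u :
  [/\ forall v, lybr v (repD rho mu x y u) = 0,
      forall v w, lytri (repD rho mu x y u) v w = 0 &
      forall v w, lytri v w (repD rho mu x y u) = 0].
Proof.
have rc a v := in_centerP (action_rho_center act a v).
have mc a b v := in_centerP (action_mu_center act a b v).
rewrite repDE; have [_ b1 c1 _ e1] := mc y x u; have [_ b2 c2 _ e2] := mc x y u.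
have [_ b3 c3 _ e3] := rc x (rho y u); have [_ b4 c4 _ e4] := rc y (rho x u).
have [_ b5 c5 _ e5] := rc (lybr x y) u.
split=> [v|v w|v w].
- by rewrite !raddfD /= !raddfN /= b1 b2 b3 b4 b5 !subr0 addr0.
- rewrite !raddfD /= !raddfN /= !add_lfunE !opp_lfunE c1 c2 c3 c4 c5.
  by rewrite !subr0 addr0.
- by rewrite !raddfD /= !raddfN /= e1 e2 e3 e4 e5 !subr0 addr0.
Qed.

Lemma cobound_fun_cocycle : cobound_fun x y \in cocycles.
Proof.
apply: (@inf_aut_cocycle (lytri x y) (repD rho mu x y)) => //.
- exact: lytri_br.
- exact: lytri_tri.
- move=> u v; rewrite repDE !(action_rho_br act, action_mu_br act).
  by rewrite !linear0 ?addr0.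
- move=> u v w; rewrite repDE !(action_rho_tri act, action_mu_tri act).
  by rewrite !linear0 ?addr0.
- by move=> u v; have [] := d_center v.
- by move=> u; have [] := d_center u.
- by move=> u v w; have [] := d_center w.
- by move=> z u; rewrite (rep_rho_triE (action_rep act)) subrK.
- by move=> z w u; rewrite (rep_mu_triE (action_rep act)) subrK.
move=> z; rewrite cobound_funE chH.2; apply: (addrI (repD rho mu x y (H z))).
by rewrite [RHS]addrC subrK !addrA.
Qed.

End Coboundaries.

Lemma sub_coboundaries_cocycles :
  is_action -> crossed_hom H -> (coboundaries <= cocycles)%VS.
Proof.
move=> act chH; apply/subvP => _ /coboundariesP[X ->].
rewrite linfunE; last exact: wedge_ext_linear.
by apply: memv_suml => p _; apply: memvZ; apply: cobound_fun_cocycle.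
Qed.

End Cohomology.

End CrossedHomomorphism.

(* Main.v *)
Require Import Defs.
From HB Require Import structures.
From mathcomp Require Import all_boot all_order all_algebra.
From mathcomp Require Import ring.

Import GRing.Theory.
Local Open Scope ring_scope.

(** In each condition imposed on [H + t H1] (being a crossed homomorphism) and
    on the pair [(Id + t L(X), Id + t D(X))] (being a morphism), both sides are
    polynomials in t, of degree at most 3, with coefficients in a vector space.
    In characteristic 0 an identity between such polynomials that holds for
    every scalar t holds coefficientwise ([cubic_coef1_eq0]), and the theorem is
    what the coefficients of t say.

    The coefficient of t in the equations of a crossed homomorphism is the
    cocycle condition on H1 ([deformation_cocycle]).  In the commutation
    [(Id + t D(X)) (H + t H2) = (H + t H1) (Id + t L(X))] it reads
    [H2 - H1 = H L(X) - D(X) H].  The right-hand side is the coboundary of X: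
    for a decomposable X this is the ternary equation of the crossed
    homomorphism H, and both sides are linear in X ([cobound_crossed_hom]). *)

Section Cubic.
Variables (K : fieldType) (V : vectType K).

Lemma coord_inj (u v : V) :
  (forall i, coord (vbasis {:V}) i u = coord (vbasis {:V}) i v) -> u = v.
Proof.
move=> uv; rewrite (coord_vbasis (memvf u)) (coord_vbasis (memvf v)).
by apply: eq_bigr => i _; rewrite uv.
Qed.

(** With P(t) for the polynomial, 12 b = 8 (P(1) - P(-1)) - (P(2) - P(-2)). *)
Lemma cubic_coef1_eq0 (char0 : [pchar K] =i pred0) (a b c d : V) :
    (forall t : K, a + t *: b + t ^+ 2 *: c + t ^+ 3 *: d = 0) ->
  b = 0.
Proof.
move=> P0; apply: coord_inj => i; rewrite linear0.
have {}P0 (t : K) : coord (vbasis {:V}) i a + t * coord (vbasis {:V}) i b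
    + t ^+ 2 * coord (vbasis {:V}) i c + t ^+ 3 * coord (vbasis {:V}) i d = 0.
  have := congr1 (coord (vbasis {:V}) i) (P0 t).
  by rewrite !linearD !linearZ linear0.
have nz12 : 12%:R != 0 :> K by rewrite ((pcharf0P K).1 char0).
apply/(mulfI nz12); rewrite mulr0.
transitivity (8%:R * (0 - 0) - (0 - 0) : K); last by ring.
by rewrite -{1}(P0 1) -{1}(P0 (- 1)) -{1}(P0 2%:R) -(P0 (- 2%:R)); ring.
Qed.

End Cubic.

Section Deformations.
Variables (K : fieldType) (char0 : [pchar K] =i pred0).
Variables (g h : lieYamagutiType K).
Variables (rho : 'Hom(g, 'End(h))) (mu : 'Hom(g, 'Hom(g, 'End(h)))).
Variable H : 'Hom(g, h).

Let linD (U V : vectType K) (f : 'Hom(U, V)) u v : f (u + v) = f u + f v.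
Proof. exact: linearD. Qed.
Let linZ (U V : vectType K) (f : 'Hom(U, V)) a u : f (a *: u) = a *: f u.
Proof. exact: linearZ. Qed.
Let coordD i (u v : h) : coord (vbasis {:h}) i (u + v)
  = coord (vbasis {:h}) i u + coord (vbasis {:h}) i v.
Proof. exact: linearD. Qed.
Let coordN i (u : h) : coord (vbasis {:h}) i (- u) = - coord (vbasis {:h}) i u.
Proof. exact: linearN. Qed.
Let coordZ i a (u : h) :
  coord (vbasis {:h}) i (a *: u) = a * coord (vbasis {:h}) i u.
Proof. exact: linearZ. Qed.

Lemma deformation_cocycle (H1 : 'Hom(g, h)) :
  linear_deformation rho mu H H1 -> cocycle rho mu H H1.
Proof.
move=> def1; split=> [x y|x y z]; rewrite /rhoH /muH /repDH.
  (* The coefficients are those of the defect of H + t H1, that is, of the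
     right-hand side minus the left-hand side of its binary equation. *)
  apply: (cubic_coef1_eq0 _ _ char0
    (rho x (H y) - rho y (H x) + lybr (H x) (H y) - H (lybr x y)) _
    (lybr (H1 x) (H1 y)) 0) => t.
  have /eqP := (def1 t).1 x y; rewrite eq_sym -subr_eq0 => /eqP P0.
  rewrite -[RHS]P0.
  rewrite [lybr (H y) _]lybrC !(add_lfunE, scale_lfunE, linD, linZ).
  rewrite scaler0 addr0.
  by apply: coord_inj => i; rewrite !(coordD, coordN, coordZ); ring.
apply: (cubic_coef1_eq0 _ _ char0
  (repD rho mu x y (H z) + mu y z (H x) - mu x z (H y)
    + lytri (H x) (H y) (H z) - H (lytri x y z)) _
  (lytri (H x) (H1 y) (H1 z) + lytri (H1 x) (H y) (H1 z)
    + lytri (H1 x) (H1 y) (H z))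
  (lytri (H1 x) (H1 y) (H1 z))) => t.
have /eqP := (def1 t).2 x y z; rewrite eq_sym -subr_eq0 => /eqP P0.
rewrite -[RHS]P0 [lytri (H1 y) _]lytriC opp_lfunE.
(* The rest is true of arbitrary linear maps in place of these. *)
move: (repD rho mu x y) (mu y z) (mu x z) (lytri x y z) (@lytri K h).
move=> D My Mx v tri.
rewrite !add_lfunE !scale_lfunE !linD !linZ !add_lfunE !scale_lfunE.
rewrite !add_lfunE !scale_lfunE.
by apply: coord_inj => i; rewrite !(coordD, coordN, coordZ); ring.
Qed.

Lemma cobound_crossed_hom (X : wedge2 g) : crossed_hom rho mu H ->
  cobound mu H X = (H \o wedgeL X)%VF - (wedgeD rho mu X \o H)%VF.
Proof.
move=> [_ H_tri]; apply/lfunP => z.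
rewrite linfunE; last exact: wedge_ext_linear.
rewrite add_lfunE opp_lfunE !comp_lfunE /wedgeL /wedgeD /wedge_ext.
rewrite !sum_lfunE linear_sum -sumrB; apply: eq_bigr => p _.
rewrite !scale_lfunE linearZ /= -scalerBr cobound_funE H_tri; congr (_ *: _).
by apply: coord_inj => i; rewrite !(coordD, coordN, coordZ); ring.
Qed.

Lemma equiv_deformations_cobound (H1 H2 : 'Hom(g, h)) :
    crossed_hom rho mu H -> equiv_deformations rho mu H H1 H2 ->
  exists X, H1 - H2 = cobound mu H X.
Proof.
move=> chH [X eqX].
(* The commutation gives H2 - H1, whence the sign. *)
exists (- X); rewrite linearN /= cobound_crossed_hom //.
apply/lfunP => z; apply/eqP; rewrite -subr_eq0; apply/eqP.
apply: (cubic_coef1_eq0 _ _ char0 0 _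
  (H1 (wedgeL X z) - wedgeD rho mu X (H2 z)) 0) => t.
have /lfunP/(_ z)/eqP := chm_comm (eqX t); rewrite eq_sym -subr_eq0 => /eqP P0.
rewrite -[RHS]P0.
rewrite !(add_lfunE, opp_lfunE, scale_lfunE, comp_lfunE, id_lfunE, linD, linZ).
rewrite scaler0 add0r addr0.
by apply: coord_inj => i; rewrite !(coordD, coordN, coordZ); ring.
Qed.

End Deformations.

Theorem theorem5p3 (K : fieldType) (char0 : [pchar K] =i pred0)
    (g h : lieYamagutiType K)
    (rho : 'Hom(g, 'End(h))) (mu : 'Hom(g, 'Hom(g, 'End(h))))
    (act : is_action rho mu)
    (H : 'Hom(g, h)) (chH : crossed_hom rho mu H)
    (H1 H2 : 'Hom(g, h))
    (def1 : linear_deformation rho mu H H1)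
    (def2 : linear_deformation rho mu H H2)
    (equiv12 : equiv_deformations rho mu H H1 H2) :
  exists (Z1 : H1 \in cocycles rho mu H) (Z2 : H2 \in cocycles rho mu H),
    cohomology_class Z1 = cohomology_class Z2.
Proof.
have /cocyclesP Z1 := deformation_cocycle _ char0 _ _ _ _ _ _ def1.
have /cocyclesP Z2 := deformation_cocycle _ char0 _ _ _ _ _ _ def2.
have [X eqX] :=
  equiv_deformations_cobound _ char0 _ _ _ _ _ _ _ chH equiv12.
exists Z1, Z2; apply/cohomology_class_eq.
by apply/coboundariesP; exists X.
Qed.
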